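(* For $k\ge1$, $$W_{112\text{-}2}(x;k)=\sum_{j=1}^k\frac{x}{(1-x^2)^j-1+x}\prod_{i=j+1}^k\frac{ix^2-1+(1-x^2)^i}{(1-x^2)^i-1+x}.$$
   Context: For $k\ge1$ let $[k]=\{1,\dots,k\}$; a $k$-ary word of length $n$ is an element of $[k]^n$. Two words are order-isomorphic if replacing the $i$-th smallest distinct letter by $i$ yields the same word. A word $w=w_1\cdots w_n$ contains the vincular pattern $112\text{-}2$ if there are indices $p$ and $q\ge p+3$ with $w_pw_{p+1}w_{p+2}w_q$ order-isomorphic to $1122$; otherwise it avoids it. $a_{112\text{-}2}(n,k)$ is the number of words in $[k]^n$ avoiding it (with $a(0,k)=1$), and $W_{112\text{-}2}(x;k)=\sum_{n\ge0}a_{112\text{-}2}(n,k)x^n$. An empty product equals $1$. *)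

(* Defs.v *)
From HB Require Import structures.
From mathcomp Require Import all_boot all_order all_algebra fraction.
From mathcomp Require Import boolp.

Set Implicit Arguments.
Unset Strict Implicit.
Unset Printing Implicit Defensive.

Import GRing.Theory.
Local Open Scope ring_scope.

(* Formal power series over an integral domain. The record is a wrapper around *)
(* coefficient sequences, which keeps the Cauchy product apart from the        *)
(* pointwise product of functions. Equality and choice are classical.          *)
Record fps (R : idomainType) := Fps { fpscoef : nat -> R }.

Section FpsRing.
Variable R : idomainType.
Implicit Types f g h : fps R.

HB.instance Definition _ := gen_eqMixin (fps R).
HB.instance Definition _ := gen_choiceMixin (fps R).

Lemma fpsP f g : (forall n, fpscoef f n = fpscoef g n) -> f = g.
Proof. by case: f => f; case: g => g /= /funext ->. Qed.

Definition fps_zero : fps R := Fps (fun _ => 0).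
Definition fps_opp f : fps R := Fps (fun n => - fpscoef f n).
Definition fps_add f g : fps R := Fps (fun n => fpscoef f n + fpscoef g n).
Definition fps_one : fps R := Fps (fun n => (n == 0%N)%:R).
Definition fps_mul f g : fps R :=
  Fps (fun n => \sum_(i < n.+1) fpscoef f i * fpscoef g (n - i)%N).

Fact fps_addA : associative fps_add.
Proof. by move=> f g h; apply: fpsP => n /=; rewrite addrA. Qed.
Fact fps_addC : commutative fps_add.
Proof. by move=> f g; apply: fpsP => n /=; rewrite addrC. Qed.
Fact fps_add0 : left_id fps_zero fps_add.
Proof. by move=> f; apply: fpsP => n /=; rewrite add0r. Qed.
Fact fps_addN : left_inverse fps_zero fps_opp fps_add.
Proof. by move=> f; apply: fpsP => n /=; rewrite addNr. Qed.

HB.instance Definition _ :=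
  GRing.isZmodule.Build (fps R) fps_addA fps_addC fps_add0 fps_addN.

Definition fps_trunc n f : {poly R} := \poly_(i < n.+1) fpscoef f i.

Lemma fps_truncE n f m : (m <= n)%N -> (fps_trunc n f)`_m = fpscoef f m.
Proof. by move=> le_mn; rewrite coef_poly ltnS le_mn. Qed.

Lemma fps_mul_trunc n f g m : (m <= n)%N ->
  fpscoef (fps_mul f g) m = (fps_trunc n f * fps_trunc n g)`_m.
Proof.
move=> le_mn; rewrite coefM /=; apply: eq_bigr => i _.
rewrite !fps_truncE //; first exact: leq_trans (leq_subr _ _) le_mn.
by rewrite (leq_trans _ le_mn) // -ltnS.
Qed.

Fact fps_mulC : commutative fps_mul.
Proof.
by move=> f g; apply: fpsP => n; rewrite !(fps_mul_trunc _ _ (leqnn n)) mulrC.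
Qed.

Fact fps_mulA : associative fps_mul.
Proof.
move=> f g h; apply: fpsP => n; pose T := fps_trunc n.
transitivity ((T f * (T g * T h))`_n).
  rewrite coefM; apply: eq_bigr => i _.
  by rewrite -(fps_mul_trunc _ _ (leq_subr i n)) fps_truncE // -ltnS.
rewrite mulrA coefM; apply: eq_bigr => i _.
by rewrite fps_truncE ?leq_subr // (@fps_mul_trunc n) // -ltnS.
Qed.

Fact fps_mul1 : left_id fps_one fps_mul.
Proof.
move=> f; apply: fpsP => n /=.
rewrite big_ord_recl mul1r subn0 big1 ?addr0 // => i _.
by rewrite /= mul0r.
Qed.

Fact fps_mulDl : left_distributive fps_mul fps_add.
Proof.
move=> f g h; apply: fpsP => n /=; rewrite -big_split.
by apply: eq_bigr => i _; rewrite mulrDl.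
Qed.

Fact fps_one_neq0 : fps_one != fps_zero.
Proof.
by apply/eqP => /(congr1 (fun f => fpscoef f 0)) /eqP; rewrite oner_eq0.
Qed.

HB.instance Definition _ := GRing.Zmodule_isComNzRing.Build (fps R)
  fps_mulA fps_mulC fps_mul1 fps_mulDl fps_one_neq0.

(* The classical unit and inverse below only serve the idomainType interface. *)
Definition fps_unit : {pred fps R} := fun f => `[< exists g, g * f = 1 >].
Definition fps_inv f : fps R :=
  if pselect (exists g, g * f = 1) is left ex_g then projT1 (cid ex_g) else f.

Fact fps_mulV : {in fps_unit, left_inverse 1 fps_inv *%R}.
Proof.
move=> f /asboolP ex_g; rewrite /fps_inv.
by case: pselect => // ex_g'; exact: projT2 (cid ex_g').
Qed.

Fact fps_unitPl f g : g * f = 1 -> fps_unit f.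
Proof. by move=> gf1; apply/asboolP; exists g. Qed.

Fact fps_inv_out : {in [predC fps_unit], fps_inv =1 id}.
Proof.
move=> f /negP nUf; rewrite /fps_inv.
by case: pselect => // ex_g; case: nUf; apply/asboolP.
Qed.

HB.instance Definition _ := GRing.ComNzRing_hasMulInverse.Build (fps R)
  fps_mulV fps_unitPl fps_inv_out.

Lemma fps_neq0_val f : f != 0 ->
  exists2 a, fpscoef f a != 0 & forall m, (m < a)%N -> fpscoef f m = 0.
Proof.
move=> f_neq0; have ex_n : exists n, fpscoef f n != 0.
  apply: contrapT => /forallNP f0; case/eqP: f_neq0.
  by apply: fpsP => n; apply/eqP/negPn/negP.
case: (ex_minnP ex_n) => a fa min_a; exists a => // m lt_ma.
by apply/eqP; apply: contraTT lt_ma => /min_a; rewrite -leqNgt.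
Qed.

Fact fps_integral : GRing.integral_domain_axiom (fps R).
Proof.
move=> f g fg0; apply: contraPT fg0; rewrite negb_or => /andP[].
move=> /fps_neq0_val[a fa f0] /fps_neq0_val[b gb g0].
move=> /(congr1 (fun h => fpscoef h (a + b))) /=.
have lt_a : (a < (a + b).+1)%N by rewrite ltnS leq_addr.
rewrite (bigD1 (Ordinal lt_a)) //= addKn big1 ?addr0 => [/eqP|i].
  by rewrite mulf_eq0 (negPf fa) (negPf gb).
rewrite -val_eqE /= neq_ltn => /orP[/f0->|lt_ai]; first by rewrite mul0r.
by rewrite g0 ?mulr0 // ltn_subLR ?ltn_add2r // -ltnS.
Qed.

HB.instance Definition _ :=
  GRing.ComUnitRing_isIntegral.Build (fps R) fps_integral.

End FpsRing.

Definition fpsX (R : idomainType) : fps R := Fps (fun n => (n == 1%N)%:R).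

(* {fraction (fps rat)} is the field of formal Laurent series Q((x)). Rational *)
(* expressions in x are read there, since (1 - x^2)^j - 1 + x is nonzero but   *)
(* has zero constant term, so it is not invertible in Q[[x]].                  *)
Notation "x %:F" := (tofrac x) : ring_scope.

Local Close Scope ring_scope.

(* Replaces the i-th smallest distinct letter of s by i. *)
Definition reduce (s : seq nat) : seq nat :=
  [seq (index a (sort leq (undup s))).+1 | a <- s].

Definition order_isomorphic (s t : seq nat) : bool := reduce s == reduce t.

(* Positions p and q are numbered from 0. *)
Definition contains_112_2 (w : seq nat) : bool :=
  [exists p : 'I_(size w), exists q : 'I_(size w), (p + 3 <= q) &&
    order_isomorphic
      [:: nth 0 w p; nth 0 w (p + 1); nth 0 w (p + 2); nth 0 w q]
      [:: 1; 1; 2; 2]].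

(* The letters 0, ..., k - 1 of 'I_k stand for 1, ..., k. *)
Definition letters (k n : nat) (w : n.-tuple 'I_k) : seq nat :=
  [seq (val c).+1 | c <- w].

Definition a_112_2 (n k : nat) : nat :=
  #|[set w : n.-tuple 'I_k | ~~ contains_112_2 (letters w)]|.

Definition W_112_2 (k : nat) : fps rat := Fps (fun n => (a_112_2 n k)%:R%R).

(* Main.v *)
(** Let [W] be the generating function for an alphabet of [k] letters, [W'] the
    one for [k - 1] letters, and [B_c] the part of [W] given by the words that
    start with [c]. Prepending [c] to an avoiding word creates an occurrence
    exactly when that word is [c b u] with [c < b] and [b] in [u]. Among the
    avoiding words [c b u] with [c < b], counted by [x * B_b], those with [b] not
    in [u] are counted by [x^2 * W'], as [u] is then any avoiding word over the
    other [k - 1] letters. With [U_c = B_c - x W'] this gives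
    [U_c = x (W - W') - x^2 * sum_(b > c) U_b], which solves to
    [x^2 * sum_c U_c = x (W - W') (1 - (1 - x^2)^k)]. Together with
    [W = 1 + sum_c U_c + k x W'] this is the recurrence
    [W ((1 - x^2)^k - 1 + x) = x + (k x^2 - 1 + (1 - x^2)^k) W'],
    and the stated formula is its iteration. *)

Require Import Defs.
From HB Require Import structures.
From mathcomp Require Import all_boot all_order all_algebra fraction.
From mathcomp Require Import ring.

Set Implicit Arguments.
Unset Strict Implicit.
Unset Printing Implicit Defensive.

Import GRing.Theory.

(** * Occurrences of the pattern as comparisons of letters *)

Lemma order_isomorphic_1122 a b c d :
  order_isomorphic [:: a; b; c; d] [:: 1; 1; 2; 2] = [&& a == b, b < c & c == d].
Proof.
apply/idP/idP; last first.
  case/and3P => /eqP <- ltac /eqP <-.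
  have ne : (a == c) = false by rewrite (ltn_eqF ltac).
  have ne' : (c == a) = false by rewrite eq_sym.
  have us : undup [:: a; a; c; c] = [:: a; c].
    by rewrite /= !inE !eqxx /= ne.
  rewrite /order_isomorphic /reduce us.
  have -> : sort leq [:: a; c] = [:: a; c].
    by rewrite sorted_sort //=; [exact: leq_trans | rewrite (ltnW ltac)].
  by rewrite /= !eqxx ne ?ne'.
rewrite /order_isomorphic /reduce.
(* Equal reductions mean that [a] and [b] have index 0, and [c] and [d] index 1, in the increasing
   list [s] of distinct letters. *)
set s := sort leq (undup [:: a; b; c; d]) => /eqP[ia ib ic id].
have ss : sorted leq s by apply: sort_sorted; exact: leq_total.
have ms z : (z \in s) = (z \in [:: a; b; c; d]) by rewrite mem_sort mem_undup.
have sa : a \in s by rewrite ms !inE eqxx.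
have sb : b \in s by rewrite ms !inE eqxx !orbT.
have sc : c \in s by rewrite ms !inE eqxx !orbT.
have sd : d \in s by rewrite ms !inE eqxx !orbT.
have ab : a = b by rewrite -(nth_index 0 sa) -(nth_index 0 sb) ia ib.
have cd : c = d by rewrite -(nth_index 0 sc) -(nth_index 0 sd) ic id.
rewrite ab cd !eqxx andbT /= ltn_neqAle; apply/andP; split.
  by apply/eqP => bd; move: ib id; rewrite bd => ->.
rewrite -(nth_index 0 sb) -(nth_index 0 sd) ib id.
apply: (sorted_leq_nth leq_trans leqnn 0 ss); rewrite // inE.
  by rewrite -ib index_mem.
by rewrite -id index_mem.
Qed.

Definition starts_112_2 (w : seq nat) : bool :=
  if w is a :: b :: c :: u then [&& a == b, b < c & c \in u] else false.

Lemma contains_112_2P w :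
  reflect (exists p q, [/\ p + 3 <= q, q < size w &
             [&& nth 0 w p == nth 0 w (p + 1), nth 0 w (p + 1) < nth 0 w (p + 2)
               & nth 0 w (p + 2) == nth 0 w q]])
          (contains_112_2 w).
Proof.
apply: (iffP existsP) => [[p /existsP[q /andP[pq]]]|[p [q [pq qw h]]]].
  by rewrite order_isomorphic_1122 => h; exists p, q; split.
have pw : p < size w by apply: leq_ltn_trans qw; rewrite (leq_trans _ pq) ?leq_addr.
exists (Ordinal pw); apply/existsP; exists (Ordinal qw).
by rewrite order_isomorphic_1122 /= pq h.
Qed.

Lemma contains_112_2_nil : contains_112_2 [::] = false.
Proof. by apply/contains_112_2P => -[p [q [_]]]. Qed.

Lemma contains_112_2_cons a w :
  contains_112_2 (a :: w) = starts_112_2 (a :: w) || contains_112_2 w.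
Proof.
apply/contains_112_2P/orP => [[[|p] [[|q] [pq]]] //|[]].
- rewrite ltnS => qw h; left; case: w qw h => [|b [|c u]] //= qw.
  + by case: q pq qw => [|[|q]].
  + case/and3P => -> -> /eqP ->; case: q pq qw => [|[|q]] //= _.
    by rewrite !ltnS => qu; rewrite mem_nth.
- rewrite ltnS => qw h; right; apply/contains_112_2P; exists p, q.
  by rewrite -ltnS.
- case: w => [|b [|c u]] //= /and3P[/eqP <- bc /(nthP 0)[q qu qc]].
  exists 0, q.+3; split; [by []|by rewrite /= !ltnS|].
  by rewrite /= eqxx bc qc eqxx.
- by case/contains_112_2P => p [q [pq qw h]]; exists p.+1, q.+1.
Qed.

(** * Counting words over an alphabet given as a list *)

Fixpoint count_words (L : seq nat) (n : nat) (P : pred (seq nat)) : nat :=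
  if n is m.+1 then \sum_(c <- L) count_words L m (fun w => P (c :: w))
  else P [::].

Lemma eq_count_words L n (P Q : pred (seq nat)) :
  (forall w, P w = Q w) -> count_words L n P = count_words L n Q.
Proof.
elim: n P Q => [|n IHn] P Q PQ /=; first by rewrite PQ.
by apply: eq_bigr => c _; apply: IHn => w; exact: PQ.
Qed.

Lemma count_words_pred0 L n : count_words L n pred0 = 0.
Proof. by elim: n => //= n IHn; rewrite big1. Qed.

Lemma count_wordsDC L n (P Q : pred (seq nat)) :
  count_words L n P = count_words L n (fun w => P w && Q w)
                      + count_words L n (fun w => P w && ~~ Q w).
Proof.
elim: n P Q => [|n IHn] P Q /=; first by case: (P _); case: (Q _).
rewrite -big_split; apply: eq_bigr => c _.
exact: (IHn (fun w => P (c :: w)) (fun w => Q (c :: w))).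
Qed.

Lemma count_words_notin L n b (P : pred (seq nat)) :
  count_words L n (fun w => P w && (b \notin w)) =
  count_words (filter (predC1 b) L) n P.
Proof.
elim: n P => [|n IHn] P /=; first by rewrite andbT.
rewrite big_filter [RHS]big_mkcond; apply: eq_bigr => c _ /=.
case: eqVneq => [->|cb] /=.
  rewrite -[RHS](count_words_pred0 L n); apply: eq_count_words => w.
  by rewrite inE eqxx andbF.
rewrite -IHn; apply: eq_count_words => w.
by rewrite inE eq_sym (negPf cb).
Qed.

Lemma card_words k n (P : pred (seq nat)) :
  #|[set w : n.-tuple 'I_k | P (letters w)]| = count_words (iota 1 k) n P.
Proof.
rewrite cardsE -sum1_card big_mkcond /=.
elim: n P => [|n IHn] P.
  rewrite (big_pred1 [tuple]) => [|w]; last by rewrite /= (tuple0 w) [RHS]eqxx.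
  by rewrite /= unfold_in; case: (P _).
rewrite (reindex (fun p : 'I_k * n.-tuple 'I_k => cons_tuple p.1 p.2)) /=; last first.
  exists (fun t : n.+1.-tuple 'I_k => (thead t, behead_tuple t)).
    by case=> c w _ /=; congr pair; apply: val_inj.
  by move=> t _; rewrite [RHS]tuple_eta; apply: val_inj.
rewrite -(pair_bigA _ 
  (fun c w => if cons_tuple c w \in (fun w => P (letters w)) then 1 else 0)) /=.
(* The element [i] of ['I_k] stands for the letter [i.+1]. *)
have iotaE : iota 1 k = [seq i.+1 | i <- index_iota 0 k].
  by rewrite /index_iota subn0 -(iotaDl 1 0).
rewrite {1}iotaE big_map big_mkord.
by apply: eq_bigr => c _; rewrite -IHn.
Qed.

(** * Generating functions of sets of words *)

Local Open Scope ring_scope.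

Definition words_gf (L : seq nat) (P : pred (seq nat)) : fps rat :=
  Fps (fun n => (count_words L n P)%:R).

Local Notation X := (fpsX rat).

Lemma fpscoefD (f g : fps rat) n :
  fpscoef (f + g) n = fpscoef f n + fpscoef g n.
Proof. by []. Qed.

Lemma fpscoef_sum (I : Type) (r : seq I) (F : I -> fps rat) n :
  fpscoef (\sum_(i <- r) F i) n = \sum_(i <- r) fpscoef (F i) n.
Proof. by apply: (big_morph (fun f : fps rat => fpscoef f n)). Qed.

Lemma fpscoefXM (f : fps rat) n :
  fpscoef (X * f) n = if n is m.+1 then fpscoef f m else 0.
Proof.
case: n => [|n] /=; first by rewrite big_ord_recl big_ord0 /= mul0r addr0.
rewrite big_ord_recl /= mul0r add0r big_ord_recl /= mul1r subSS subn0.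
by rewrite big1 ?addr0 // => i _; rewrite /= mul0r.
Qed.

Lemma eq_words_gf L (P Q : pred (seq nat)) :
  (forall w, P w = Q w) -> words_gf L P = words_gf L Q.
Proof. by move=> PQ; apply: fpsP => n /=; rewrite (eq_count_words _ _ PQ). Qed.

Lemma words_gf_cons L (P : pred (seq nat)) :
  words_gf L P =
  (P [::])%:R + X * \sum_(c <- L) words_gf L (fun w => P (c :: w)).
Proof.
apply: fpsP => n.
rewrite fpscoefD fpscoefXM; case: n => [|n].
  by rewrite addr0 /=; case: (P [::]) => /=; rewrite ?eqxx.
rewrite fpscoef_sum -natr_sum.
by case: (P [::]); rewrite add0r.
Qed.

Lemma words_gfDC L (P Q : pred (seq nat)) :
  words_gf L P = words_gf L (fun w => P w && Q w)
                 + words_gf L (fun w => P w && ~~ Q w).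
Proof. by apply: fpsP => n /=; rewrite (count_wordsDC _ _ P Q) natrD. Qed.

Lemma words_gf_notin L b (P : pred (seq nat)) :
  words_gf L (fun w => P w && (b \notin w)) = words_gf (filter (predC1 b) L) P.
Proof. by apply: fpsP => n /=; rewrite count_words_notin. Qed.

Lemma words_gf_pred0 L : words_gf L pred0 = 0.
Proof. by apply: fpsP => n /=; rewrite count_words_pred0. Qed.

(** * Avoiding words by first letter, and the recurrence in the alphabet size *)

Definition avoids_112_2 (w : seq nat) : bool := ~~ contains_112_2 w.

(** This is [B_c]; the factor [X] accounts for the leading [c] itself. *)
Definition avoiders_from (L : seq nat) (c : nat) : fps rat :=
  X * words_gf L (fun w => avoids_112_2 (c :: w)).

(** An occurrence starting at the first letter would need that letter twice. *)
Lemma avoids_112_2_fresh b u :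
  b \notin u -> avoids_112_2 (b :: u) = avoids_112_2 u.
Proof.
rewrite /avoids_112_2 contains_112_2_cons.
by case: u => [|c [|d u]] //=; rewrite inE; case: (b == c).
Qed.

Lemma avoiders_fromE (L : seq nat) (c : nat) : uniq L -> c \in L ->
  avoiders_from L c = X * words_gf L avoids_112_2 - X ^+ 2 *
    \sum_(b <- L | (c < b)%N)
      (avoiders_from L b - X * words_gf (filter (predC1 b) L) avoids_112_2).
Proof.
move=> uL cL.
(* [Q] singles out the words in front of which [c] creates an occurrence. *)
pose Q w := starts_112_2 (c :: w).
have -> : words_gf L avoids_112_2 = words_gf L (fun w => avoids_112_2 w && Q w)
      + words_gf L (fun w => avoids_112_2 (c :: w)).
  rewrite (words_gfDC _ _ Q); congr (_ + _); apply: eq_words_gf => w.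
  by rewrite /avoids_112_2 contains_112_2_cons negb_or andbC.
suff -> : words_gf L (fun w => avoids_112_2 w && Q w) = X *
    \sum_(b <- L | (c < b)%N)
      (avoiders_from L b - X * words_gf (filter (predC1 b) L) avoids_112_2).
  by rewrite /avoiders_from; ring.
rewrite words_gf_cons andbF add0r; congr (_ * _).
(* Only words beginning with [c] can satisfy [Q]. *)
rewrite (bigD1_seq c) //= [X in _ + X]big1 ?addr0; last first.
  move=> d dc; rewrite -[RHS](words_gf_pred0 L); apply: eq_words_gf => w.
  by rewrite /Q; case: w => [|e u] /=; rewrite ?andbF // eq_sym (negPf dc) andbF.
rewrite words_gf_cons andbF add0r mulr_sumr [RHS]big_mkcond /=.
apply: eq_bigr => b _.
rewrite /Q /= eqxx /=; case: ltnP => [ltcb|_] /=; last first.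
  rewrite -[RHS](mulr0 X) -(words_gf_pred0 L); congr (_ * _).
  by apply: eq_words_gf => w; rewrite andbF.
have avcb w : avoids_112_2 (c :: b :: w) = avoids_112_2 (b :: w).
  rewrite /avoids_112_2 (contains_112_2_cons c).
  by case: w => [|d u] //=; rewrite (ltn_eqF ltcb).
(* [B_b] splits according to whether [b] recurs in the tail; the words where it does not are the
   ones subtracted. *)
rewrite /avoiders_from
  (words_gfDC _ (fun w => avoids_112_2 (b :: w)) (fun u => b \in u)).
have -> : words_gf L (fun w => avoids_112_2 (b :: w) && ~~ (b \in w))
        = words_gf (filter (predC1 b) L) avoids_112_2.
  rewrite -words_gf_notin; apply: eq_words_gf => w.
  by case: (boolP (b \in w)) => bw; rewrite ?andbF // avoids_112_2_fresh.
rewrite mulrDr addrK; congr (_ * _).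
by apply: eq_words_gf => w; rewrite avcb.
Qed.

(** Put [T = y * sum f]. A new least element [c] has [f c = A - T], so [T] becomes
    [y * A + (1 - y) * T], and [A - T] is multiplied by [1 - y]. *)
Lemma sum_sorted_rec (R : comPzRingType) (A y : R) (f : nat -> R) (s : seq nat) :
  sorted ltn s ->
  {in s, forall c, f c = A - y * \sum_(b <- s | (c < b)%N) f b} ->
  y * \sum_(c <- s) f c = A * (1 - (1 - y) ^+ size s).
Proof.
elim: s => [|c s IHs] /=; first by rewrite big_nil expr0 subrr !mulr0.
move=> cs fE; have lt_c := order_path_min ltn_trans cs.
have /IHs IH : sorted ltn s by exact: path_sorted cs.
have {}IH : y * \sum_(b <- s) f b = A * (1 - (1 - y) ^+ size s).
  apply: IH => b bs; rewrite fE ?inE ?bs ?orbT // big_cons.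
  by rewrite ltnNge ltnW //; exact: (allP lt_c).
rewrite big_cons fE ?mem_head // big_cons ltnn.
rewrite [X in A - y * X]big_seq_cond (eq_bigl (fun b => b \in s)); last first.
  by move=> b; case: (boolP (b \in s)) => // /(allP lt_c) /= ->.
rewrite -big_seq mulrDr IH exprS; ring.
Qed.

(** That the series [W'] is the same whichever letter is deleted is assumed here; the later
    induction on the alphabet size supplies it. *)
Lemma words_gf_rec L (W' : fps rat) : sorted ltn L ->
  {in L, forall b, words_gf (filter (predC1 b) L) avoids_112_2 = W'} ->
  words_gf L avoids_112_2 * ((1 - X ^+ 2) ^+ size L - 1 + X) =
  X + ((size L)%:R * X ^+ 2 - 1 + (1 - X ^+ 2) ^+ size L) * W'.
Proof.
move=> sL WE; set W := words_gf L _.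
have uL : uniq L by apply: sorted_uniq sL; [exact: ltn_trans | exact: ltnn].
have := @sum_sorted_rec _ (X * (W - W')) (X ^+ 2)
  (fun c => avoiders_from L c - X * W') L sL.
have W1 : W = 1 + \sum_(c <- L) avoiders_from L c.
  rewrite /W words_gf_cons mulr_sumr /avoids_112_2 contains_112_2_nil //.
have -> : \sum_(c <- L) (avoiders_from L c - X * W') = W - 1 - (size L)%:R * (X * W').
  rewrite W1 sumrB big_const_seq count_predT iter_addr_0 mulr_natl; ring.
set S := (1 - X ^+ 2) ^+ _; move=> H.
have {}H : X ^+ 2 * (W - 1 - (size L)%:R * (X * W')) = X * (W - W') * (1 - S).
  apply: H => c cL; rewrite avoiders_fromE // mulrBr.
  rewrite -/W addrAC; congr (_ - _ * _).
  rewrite big_seq_cond [RHS]big_seq_cond; apply: eq_bigr => b /andP[bL _].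
  by rewrite WE.
have X0 : X != 0.
  by apply/eqP => /(congr1 (fun f => fpscoef f 1)) /= /eqP; rewrite oner_eq0.
(* [H] is the claim multiplied by [X], up to moving terms across. *)
apply: (mulfI X0).
apply/eqP; rewrite -subr_eq0; apply/eqP.
transitivity (X ^+ 2 * (W - 1 - (size L)%:R * (X * W'))
  - X * (W - W') * (1 - S)); first ring.
by rewrite H subrr.
Qed.

(** Modulo [X ^+ 2] the power is 1, so the coefficient of degree 1 of the whole expression is 1. *)
Lemma fps_denom_neq0 k : (1 - X ^+ 2) ^+ k - 1 + X != 0.
Proof.
have [g ->] : exists g, (1 - X ^+ 2) ^+ k = 1 - X ^+ 2 * g.
  elim: k => [|k [g IHk]]; first by exists 0; rewrite mulr0 subr0.
  by exists (g + 1 - X ^+ 2 * g); rewrite exprS IHk; ring.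
have -> : 1 - X ^+ 2 * g - 1 + X = X * (1 + X * (- g)) by ring.
apply/eqP => /(congr1 (fun f => fpscoef f 1)).
rewrite fpscoefXM.
by rewrite fpscoefD fpscoefXM addr0 => /eqP; rewrite oner_eq0.
Qed.

(** * Iterating the recurrence in the fraction field *)

Section Formula.
Variables (F : fieldType) (x : F).

Definition avoider_formula (k : nat) : F :=
  \sum_(1 <= j < k.+1)
     (x / ((1 - x ^+ 2) ^+ j - 1 + x) *
      \prod_(j.+1 <= i < k.+1)
         ((i%:R * x ^+ 2 - 1 + (1 - x ^+ 2) ^+ i) /
          ((1 - x ^+ 2) ^+ i - 1 + x))).

(** The new term [j = k.+1] has an empty product; every older term gains the factor [i = k.+1]. *)
Lemma avoider_formulaS k :
  avoider_formula k.+1 =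
  (x + (k.+1%:R * x ^+ 2 - 1 + (1 - x ^+ 2) ^+ k.+1) * avoider_formula k) /
  ((1 - x ^+ 2) ^+ k.+1 - 1 + x).
Proof.
rewrite /avoider_formula big_nat_recr //= (@big_geq _ _ _ k.+2) // mulr1 mulrDl addrC.
congr (_ + _); rewrite mulrAC mulr_sumr big_nat [RHS]big_nat.
apply: eq_bigr => j /andP[_ jk]; rewrite big_nat_recr //=.
by rewrite mulrA mulrC.
Qed.

End Formula.

Lemma words_gf_frac_rec L (W' : fps rat) : sorted ltn L ->
  {in L, forall b, words_gf (filter (predC1 b) L) avoids_112_2 = W'} ->
  let x := X%:F in
  (words_gf L avoids_112_2)%:F =
  (x + ((size L)%:R * x ^+ 2 - 1 + (1 - x ^+ 2) ^+ size L) * W'%:F) /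
  ((1 - x ^+ 2) ^+ size L - 1 + x).
Proof.
move=> sL /(words_gf_rec sL) /(congr1 (@tofrac _)) + x; rewrite rmorphM /=.
have := fps_denom_neq0 (size L); rewrite -tofrac_eq0.
rewrite !(rmorph_nat, rmorphD, rmorphB, rmorphXn, rmorphN, rmorph1, rmorphM) /=.
by move=> D0 <-; rewrite mulfK.
Qed.

(** Arbitrary increasing alphabets are needed for the induction, since deleting a letter from an
    interval may leave a gap. *)
Lemma words_gf_avoider_formula k L : sorted ltn L -> size L = k.+1 ->
  (words_gf L avoids_112_2)%:F = avoider_formula X%:F k.+1.
Proof.
elim: k L => [|k IHk] L sL szL.
  (* The empty alphabet has series 1 whereas the formula gives 0 there. For one letter the
     coefficient of [W'] is [x^2 - 1 + (1 - x^2) = 0], so both yield the same value. *)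
  rewrite (@words_gf_frac_rec L 1) //; last first.
    case: L {sL} szL => [|a []] // _ b; rewrite inE => /eqP ->.
    rewrite /= eqxx words_gf_cons big_nil mulr0 addr0.
    by rewrite /avoids_112_2 contains_112_2_nil.
  rewrite szL avoider_formulaS /avoider_formula big_geq // mulr0.
  by congr ((_ + _) / _); rewrite rmorph1; ring.
have uL : uniq L by apply: sorted_uniq sL; [exact: ltn_trans | exact: ltnn].
have IH b : b \in L ->
  (words_gf (filter (predC1 b) L) avoids_112_2)%:F = avoider_formula X%:F k.+1.
  move=> bL; apply: IHk; first by apply: sorted_filter => //; exact: ltn_trans.
  by rewrite -rem_filter // size_rem // szL.
have [a aL] : exists a, a \in L.
  by case: L szL {sL uL IH} => // a L; exists a; exact: mem_head.
rewrite (words_gf_frac_rec (W' := words_gf (filter (predC1 a) L) avoids_112_2)) //.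
  by rewrite szL avoider_formulaS IH.
(* By induction all these series have the same image in the fraction field, and the embedding is
   injective. *)
by move=> b bL; apply/eqP; rewrite -tofrac_eq !IH.
Qed.

Theorem theorem4p4 (k : nat) (hk : (1 <= k)%N) :
  let x : {fraction (fps rat)} := (fpsX rat)%:F in
  (W_112_2 k)%:F =
  \sum_(1 <= j < k.+1)
     (x / ((1 - x ^+ 2) ^+ j - 1 + x) *
      \prod_(j.+1 <= i < k.+1)
         ((i%:R * x ^+ 2 - 1 + (1 - x ^+ 2) ^+ i) /
          ((1 - x ^+ 2) ^+ i - 1 + x))).
Proof.
move=> x; case: k hk => // k _.
rewrite -/(avoider_formula x k.+1).
rewrite -(@words_gf_avoider_formula k (iota 1 k.+1)) ?size_iota ?iota_ltn_sorted //.
congr tofrac; apply: fpsP => n /=; congr _%:R.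
exact: (card_words k.+1 n avoids_112_2).
Qed.
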